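(* Let $(X,d)$ be a complete metric space, $m,L\in\mathbb{N}$, $a_0,\dots,a_{m-1}\ge0$ with $\alpha:=\sum_{i=0}^{m-1}a_i<1$, and let $\mathcal{S}=(X,(\phi_j)_{j=1}^L,(p_j)_{j=1}^L)$ be a GIFS with probabilities of order $m$ consisting of $(a_0,\dots,a_{m-1})$-contractions. Let $\varepsilon>0$, $\hat X$ a proper $\varepsilon$-net of $X$, $r:X\to\hat{X}$ a Borel measurable $\varepsilon$-projection, and $\hat{\mathcal{S}}:=(\hat{X},(\hat\phi_j)_{j=1}^L,(p_j)_{j=1}^L)$ with $\hat\phi_j:=(r\circ\phi_j)|_{\hat{X}^m}$. Then for any $\nu\in\mathcal{P}(\hat{X})$ and $n\in\mathbb{N}$, $$d_{MK}\big(e^\sharp(\overline{M}^n_{\hat{\mathcal{S}}}(\nu)),\mu_\mathcal{S}\big)\le\frac{\varepsilon}{1-\alpha}+\alpha^n\,d_{MK}(e^\sharp(\nu),\mu_\mathcal{S}),$$ where $\mu_\mathcal{S}$ is the generalized Hutchinson measure of $\mathcal{S}$. In particular, there is $n_0\in\mathbb{N}$ such that for every $n\ge n_0$, $d_{MK}(e^\sharp(\overline{M}^n_{\hat{\mathcal{S}}}(\nu)),\mu_\mathcal{S})\le\frac{2\varepsilon}{1-\alpha}$.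
   Context: $X^m$ carries the maximum metric; $f:X^m\to X$ is an $(a_0,\dots,a_{m-1})$-contraction if $d(f(x_0,\dots,x_{m-1}),f(y_0,\dots,y_{m-1}))\le\sum_i a_i d(x_i,y_i)$. A GIFS with probabilities of order $m$ is $(X,(\phi_j)_{j=1}^L,(p_j)_{j=1}^L)$ with continuous $\phi_j:X^m\to X$, $p_j>0$, $\sum p_j=1$. $\mathcal{P}(Y)$: Borel probability measures on $Y$ with compact support. $w^\sharp\mu(B)=\mu(w^{-1}(B))$. $M_\mathcal{S}(\mu_0,\dots,\mu_{m-1})=\sum_jp_j\phi_j^\sharp(\mu_0\times\dots\times\mu_{m-1})$, $\overline{M}_\mathcal{S}(\mu)=M_\mathcal{S}(\mu,\dots,\mu)$; $\overline{M}_{\hat{\mathcal{S}}}$ is defined analogously on $\mathcal{P}(\hat X)$ with the $\hat\phi_j$. $d_{MK}(\mu,\nu)=\sup\{|\int fd\mu-\int fd\nu|:\mathrm{Lip}(f)\le1\}$. The generalized Hutchinson measure is the unique $\mu_\mathcal{S}\in\mathcal{P}(X)$ with $\mu_\mathcal{S}=M_\mathcal{S}(\mu_\mathcal{S},\dots,\mu_\mathcal{S})$ such that for all $\mu_0,\dots,\mu_{m-1}\in\mathcal P(X)$ the sequence $\mu_{m+k}:=M_\mathcal{S}(\mu_k,\dots,\mu_{k+m-1})$ converges to it in $d_{MK}$ (it exists under these hypotheses). $e:\hat X\to X$ is the inclusion. $\hat X$ is an $\varepsilon$-net if every point of $X$ is within $\varepsilon$ of $\hat X$; proper if its intersection with every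 bounded set is finite. $r$ is an $\varepsilon$-projection if $r|_{\hat X}=\mathrm{id}$ and $d(x,r(x))\le\varepsilon$. *)

(* Defs.v *)
From HB Require Import structures.
From mathcomp Require Import all_boot all_order all_algebra.
From mathcomp Require Import all_classical all_reals all_analysis.
Set Implicit Arguments. Unset Strict Implicit. Unset Printing Implicit Defensive.
Import Order.TTheory GRing.Theory Num.Theory.
Local Open Scope classical_set_scope.
Local Open Scope ring_scope.

Section metric.
Variables (R : realType) (T : Type) (d : T -> T -> R).

Definition is_metric : Prop :=
  [/\ forall x y, 0 <= d x y, forall x y, d x y = 0 <-> x = y,
      forall x y, d x y = d y x & forall x y z, d x z <= d x y + d y z].

Definition dcauchy (u : nat -> T) : Prop :=
  forall e, 0 < e -> exists N, forall k l, (N <= k)%N -> (N <= l)%N -> d (u k) (u l) < e.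

Definition dconverges (u : nat -> T) (x : T) : Prop :=
  forall e, 0 < e -> exists N, forall k, (N <= k)%N -> d (u k) x < e.

Definition dcomplete : Prop :=
  forall u, dcauchy u -> exists x, dconverges u x.

Definition dball (x : T) (r : R) : set T := [set y | d x y < r].

Definition dopen (A : set T) : Prop :=
  forall x, A x -> exists r, 0 < r /\ dball x r `<=` A.

(* sequential compactness (= compactness in metric spaces) *)
Definition dcompact (K : set T) : Prop :=
  forall u : nat -> T, (forall k, K (u k)) ->
  exists (s : nat -> nat) (x : T),
    (forall k, (s k < s k.+1)%N) /\ K x /\ dconverges (u \o s) x.

Definition dbounded (B : set T) : Prop :=
  exists x0 r, B `<=` [set y | d x0 y <= r].

Definition lip1 (f : T -> R) : Prop := forall x y, `|f x - f y| <= d x y.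

Definition dcontinuous (U : Type) (dU : U -> U -> R) (f : U -> T) : Prop :=
  forall x e, 0 < e -> exists del, 0 < del /\
    forall y, dU x y < del -> d (f x) (f y) < e.

End metric.

Definition dmax (R : realType) (T : Type) (m : nat) (d : T -> T -> R)
  (x y : 'I_m -> T) : R := \big[Num.max/0]_(i < m) d (x i) (y i).

Definition borel_type (R : realType) (T : pointedType) (d : T -> T -> R) :=
  g_sigma_algebraType (dopen d).

Definition bmeasurable (R : realType) (T : pointedType) (d : T -> T -> R)
  (A : set T) : Prop := @measurable _ (borel_type d) A.

Definition pushf (R : realType) (U V : Type) (mu : set U -> \bar R) (w : U -> V)
  : set V -> \bar R := fun B => mu (w @^-1` B).

(* mu is in P(T): a Borel probability measure with compact support *)
Definition inP (R : realType) (T : pointedType) (d : T -> T -> R)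
  (mu : set T -> \bar R) : Prop :=
  exists P : probability (borel_type d) R,
    (forall A, P A = mu A) /\
    exists K, dcompact d K /\ mu K = 1%E.

Definition meq (R : realType) (T : pointedType) (d : T -> T -> R)
  (mu nu : set T -> \bar R) : Prop :=
  forall A, bmeasurable d A -> mu A = nu A.

Definition is_prodm (R : realType) (T : pointedType) (d : T -> T -> R) (m : nat)
  (mus : 'I_m -> set T -> \bar R) (pi : set ('I_m -> T) -> \bar R) : Prop :=
  inP (dmax d) pi /\
  forall B : 'I_m -> set T, (forall i, bmeasurable d (B i)) ->
    pi [set x | forall i, B i (x i)] = (\prod_(i < m) mus i (B i))%E.

(* the product measure (chosen; it exists and is unique for mus in P(T)) *)
Definition prodm (R : realType) (T : pointedType) (d : T -> T -> R) (m : nat)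
  (mus : 'I_m -> set T -> \bar R) : set ('I_m -> T) -> \bar R :=
  match pselect (exists pi, is_prodm d mus pi) with
  | left H => projT1 (cid H)
  | right _ => fun _ => 0%E
  end.

Definition MS (R : realType) (T : pointedType) (d : T -> T -> R) (m L : nat)
  (p : 'I_L -> R) (phi : 'I_L -> ('I_m -> T) -> T)
  (mus : 'I_m -> set T -> \bar R) : set T -> \bar R :=
  fun B => (\sum_(j < L) (p j)%:E * pushf (prodm d mus) (phi j) B)%E.

Definition MSbar (R : realType) (T : pointedType) (d : T -> T -> R) (m L : nat)
  (p : 'I_L -> R) (phi : 'I_L -> ('I_m -> T) -> T)
  (mu : set T -> \bar R) : set T -> \bar R :=
  MS d p phi (fun _ => mu).

Definition dMK (R : realType) (T : pointedType) (d : T -> T -> R)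
  (mu nu : set T -> \bar R) : \bar R :=
  ereal_sup [set `| (\int[mu : set (borel_type d) -> \bar R]_x (f x)%:E
                     - \int[nu : set (borel_type d) -> \bar R]_x (f x)%:E) |%E
            | f in [set f : T -> R | lip1 d f]].

Definition is_GIFS (R : realType) (T : Type) (d : T -> T -> R) (m L : nat)
  (p : 'I_L -> R) (phi : 'I_L -> ('I_m -> T) -> T) : Prop :=
  (forall j, dcontinuous d (dmax d) (phi j)) /\
  (forall j, 0 < p j) /\ \sum_(j < L) p j = 1.

Definition is_acontraction (R : realType) (T : Type) (d : T -> T -> R) (m : nat)
  (a : 'I_m -> R) (f : ('I_m -> T) -> T) : Prop :=
  forall x y, d (f x) (f y) <= \sum_(i < m) a i * d (x i) (y i).

Definition is_hutchinson (R : realType) (T : pointedType) (d : T -> T -> R)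
  (m L : nat) (p : 'I_L -> R) (phi : 'I_L -> ('I_m -> T) -> T)
  (muS : set T -> \bar R) : Prop :=
  [/\ inP d muS,
      meq d muS (MSbar d p phi muS) &
      forall mu : nat -> set T -> \bar R,
        (forall k, (k < m)%N -> inP d (mu k)) ->
        (forall k, mu (k + m)%N = MS d p phi (fun i : 'I_m => mu (k + i)%N)) ->
        (fun k => dMK d (mu k) muS) @ \oo --> 0%E].

(* Main.v *)
(* One step of the discretized iteration costs at most eps (moving the image
   points by r) plus the contraction M_S, so with D_n the distance at time n,
   D_(n+1) <= eps + alpha D_n and the bound is the geometric series.  That M_S
   contracts d_MK by alpha is proved without Fubini: both measures have compact
   support, so a common finite partition into pieces of small diameter replaces
   the integrals against them, and against their products, by finite sums up to
   an arbitrarily small error; for finite sums, the factors of the product are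
   exchanged one coordinate at a time. *)

(* [prodm] is a chosen measure with default value zero, and the Borel sigma-algebra of [dmax d] may
   be strictly larger than the product sigma-algebra when the space is not separable. So every
   product measure that occurs must first be shown to exist. On the discrete space, compact sets are
   bounded, hence finite by properness, and products are explicit finite sums of point masses. On X,
   the product of the pushed-forward measure is the pushforward of such a product, and that of [muS]
   is forced by the fixed-point equation. What is then known of a product is its value on boxes.
   This suffices, because a Lipschitz integrand is nearly constant on a box with small sides. The
   factor alpha arises since exchanging coordinate [i] costs [a i] times the distance of the two
   factors. *)
Require Import Defs.
From HB Require Import structures.
From mathcomp Require Import all_boot all_order all_algebra.
From mathcomp Require Import all_classical all_reals all_analysis.
From mathcomp Require Import measurable_realfun ring lra.
Set Implicit Arguments. Unset Strict Implicit. Unset Printing Implicit Defensive.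
Import Order.TTheory GRing.Theory Num.Theory.
Local Open Scope classical_set_scope.
Local Open Scope ring_scope.

(** * Product weights on finite sets *)

Section finite_products.
Variables (R : realType) (m : nat) (I : finType).

Definition updf (k : {ffun 'I_m -> I}) (q : 'I_m) (x : I) : {ffun 'I_m -> I} :=
  [ffun i => if i == q then x else k i].

(** The functions with [k q = x0] are representatives for the choices of all coordinates other than
    [q]; the inner sum restores coordinate [q]. *)
Lemma sum_ffun_split (F : {ffun 'I_m -> I} -> R) (q : 'I_m) (x0 : I) :
  \sum_k F k = \sum_(k : {ffun 'I_m -> I} | k q == x0) \sum_x F (updf k q x).
Proof.
rewrite exchange_big /=.
rewrite (partition_big (fun k : {ffun 'I_m -> I} => k q) predT) //=.
apply: eq_bigr => x _.
rewrite (reindex_onto (fun k => updf k q x) (fun k => updf k q x0)) /=; last first.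
  move=> k /eqP kq; apply/ffunP => i; rewrite !ffunE.
  by case: eqVneq => // ->.
apply: eq_bigl => k; rewrite ffunE eqxx eqxx /=.
apply/eqP/eqP => [<-|kq]; first by rewrite ffunE eqxx.
by apply/ffunP => i; rewrite !ffunE; case: eqVneq => // ->.
Qed.

Variables (T : Type) (d : T -> T -> R) (t : I -> T).

(** For [c > 0], rescale [h] by [c^-1] and use it as a test function. For [c = 0], [h] is constant
    and the equal total masses cancel. *)
Lemma lip_weight_diff (u v : I -> R) (D c : R) (h : T -> R) :
  \sum_i u i = \sum_i v i ->
  (forall f, lip1 d f -> `|\sum_i f (t i) * u i - \sum_i f (t i) * v i| <= D) ->
  0 <= c -> (forall x y, `|h x - h y| <= c * d x y) ->
  `|\sum_i h (t i) * u i - \sum_i h (t i) * v i| <= c * D.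
Proof.
move=> uv HD c0 hc.
case: (eqVneq c 0) => [c00|cn0].
  have [i0 _|I0] := pickP I; last first.
    by rewrite !big1 ?subr0 ?c00 ?mul0r ?normr0// => i; have := I0 i.
  have hE x : h x = h (t i0).
    apply/eqP; rewrite -subr_eq0 -normr_le0.
    by apply: le_trans (hc _ _) _; rewrite c00 mul0r.
  under eq_bigr do rewrite hE.
  under [X in _ - X]eq_bigr do rewrite hE.
  by rewrite -!mulr_sumr uv subrr normr0 c00 mul0r.
have cp : 0 < c by rewrite lt_neqAle eq_sym cn0.
have lh : lip1 d (fun x => c^-1 * h x).
  move=> x y; rewrite -mulrBr normrM ger0_norm ?invr_ge0// mulrC ler_pdivrMr//.
  by rewrite mulrC.
have := HD _ lh.
under eq_bigr do rewrite -mulrA.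
under [X in _ - X]eq_bigr do rewrite -mulrA.
rewrite -!mulr_sumr -mulrBr normrM ger0_norm ?invr_ge0//.
by rewrite mulrC ler_pdivrMr// mulrC.
Qed.

Lemma sum_prod_weights (w : 'I_m -> I -> R) :
  (forall i, \sum_x w i x = 1) ->
  \sum_(k : {ffun 'I_m -> I}) \prod_i w i (k i) = 1.
Proof. by move=> w1; rewrite -bigA_distr_bigA big1. Qed.

(* Replacing one coordinate at a time, the section of [g] at that coordinate is
   [a i]-Lipschitz whatever the other coordinates are. *)
Lemma prod_weight_diff (u v : I -> R) (a : 'I_m -> R) (D : R)
    (g : ('I_m -> T) -> R) :
  (forall x, d x x = 0) ->
  (forall i, 0 <= u i) -> (forall i, 0 <= v i) ->
  \sum_i u i = 1 -> \sum_i v i = 1 ->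
  (forall f, lip1 d f -> `|\sum_i f (t i) * u i - \sum_i f (t i) * v i| <= D) ->
  (forall i, 0 <= a i) ->
  (forall x y, `|g x - g y| <= \sum_i a i * d (x i) (y i)) ->
  `| \sum_(k : {ffun 'I_m -> I}) g (t \o k) * \prod_i u (k i)
   - \sum_(k : {ffun 'I_m -> I}) g (t \o k) * \prod_i v (k i) |
  <= (\sum_i a i) * D.
Proof.
move=> dxx u0 v0 u1 v1 HD a0 gl.
have [x0 _|I0] := pickP I; last first.
  by move: u1; rewrite big1 => [/eqP|i]; [rewrite eq_sym oner_eq0|have := I0 i].
(* Hybrid weights: [u] on the first [n] coordinates, [v] on the others, so [W] interpolates between
   the [v]-sum at 0 and the [u]-sum at [m]. *)
pose h (n : nat) (i : 'I_m) := if (i < n)%N then u else v.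
pose W n := \sum_(k : {ffun 'I_m -> I}) g (t \o k) * \prod_i h n i (k i).
have h0 n i x : 0 <= h n i x by rewrite /h; case: ifP.
have h1 n i : \sum_x h n i x = 1 by rewrite /h; case: ifP.
have step (q : 'I_m) : `|W q.+1 - W q| <= a q * D.
  have key (k : {ffun 'I_m -> I}) :
      `|\sum_x g (t \o updf k q x) * u x - \sum_x g (t \o updf k q x) * v x|
      <= a q * D.
    pose gq (y : T) := g (fun i => if i == q then y else t (k i)).
    have gqE x : g (t \o updf k q x) = gq (t x).
      congr g; apply/funext => i /=; rewrite ffunE; by case: ifP.
    under eq_bigr do rewrite gqE.
    under [X in _ - X]eq_bigr do rewrite gqE.
    apply: (lip_weight_diff (h := gq)) => //; first by rewrite u1 v1.
    move=> x y; apply: le_trans (gl _ _) _.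
    rewrite (bigD1 q) //= eqxx big1 ?addr0// => i /negbTE ->.
    by rewrite dxx mulr0.
  have prodE n (k : {ffun 'I_m -> I}) x :
      \prod_i h n i (updf k q x i) =
      h n q x * \prod_(i | i != q) h n i (k i).
    rewrite (bigD1 q)//= ffunE eqxx; congr (_ * _).
    by apply: eq_bigr => i /negbTE iq; rewrite ffunE iq.
  have hq (k : {ffun 'I_m -> I}) :
     \prod_(i | i != q) h q.+1 i (k i) = \prod_(i | i != q) h q i (k i).
    apply: eq_bigr => i iq; rewrite /h ltnS leq_eqVlt.
    by rewrite (_ : (i == q :> nat) = false)//; apply/negbTE.
  have hu : h q.+1 q = u by rewrite /h ltnSn.
  have hv : h q q = v by rewrite /h ltnn.
  rewrite /W !(sum_ffun_split _ q x0) -sumrB.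
  (* The weights of the coordinates other than [q] have total mass 1, so averaging [key] over them
     preserves the bound [a q * D]. *)
  have tot : \sum_(k : {ffun 'I_m -> I} | k q == x0)
               \prod_(i | i != q) h q i (k i) = 1.
    rewrite -[RHS](sum_prod_weights (h1 q)) (sum_ffun_split _ q x0).
    apply: eq_bigr => k _; rewrite (eq_bigr _ (fun x _ => prodE q k x)).
    by rewrite -mulr_suml h1 mul1r.
  rewrite -[leRHS]mul1r -[X in _ <= X * _]tot mulr_suml.
  apply: le_trans (ler_norm_sum _ _ _) _.
  apply: ler_sum => k _.
  have E n : \sum_x g (t \o updf k q x) * (\prod_i h n i (updf k q x i)) =
      (\sum_x g (t \o updf k q x) * h n q x) * \prod_(i | i != q) h n i (k i).
    by rewrite mulr_suml; apply: eq_bigr => x _; rewrite prodE mulrA.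
  rewrite !E hq hu hv -mulrBl normrM mulrC.
  rewrite ger0_norm; last by apply: prodr_ge0.
  by apply: ler_wpM2l (key k); apply: prodr_ge0.
have Wu : W m = \sum_(k : {ffun 'I_m -> I}) g (t \o k) * \prod_i u (k i).
  by apply: eq_bigr => k _; congr (_ * _); apply: eq_bigr => i _; rewrite /h ltn_ord.
have Wv : W 0%N = \sum_(k : {ffun 'I_m -> I}) g (t \o k) * \prod_i v (k i).
  by apply: eq_bigr => k _; congr (_ * _).
rewrite -Wu -Wv -telescope_sumr// big_mkord.
apply: le_trans (ler_norm_sum _ _ _) _.
by rewrite mulr_suml; apply: ler_sum => q _; exact: step.
Qed.

End finite_products.

(** * Integrals approximated over finite partitions *)

Section finite_partitions.
Context (disp : measure_display) (T : measurableType disp) (R : realType).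
Variables (P : probability T R) (J : finType) (C : J -> set T).
Hypothesis mC : forall j, measurable (C j).
Hypothesis tC : forall i j x, C i x -> C j x -> i = j.

Lemma probability_partition :
  P (\bigcup_j C j) = (\sum_j P (C j))%E.
Proof.
have eT : [set: J] = [set` enum J].
  by apply/seteqP; split=> // j _ /=; rewrite mem_enum.
rewrite measure_fin_bigcup//; first last.
- by move=> i j _ _ [x [Ci Cj]]; exact: (tC Ci Cj).
- exact: finite_finset.
by rewrite eT -fsbig_seq ?enum_uniq// big_enum.
Qed.

Hypothesis C1 : (\sum_j P (C j) = 1)%E.

(** The cells need not cover [T]: by [C1] their complement is a null set. *)
Lemma ae_partition (Q : T -> Prop) :
  (forall j x, C j x -> Q x) -> {ae P, forall x, Q x}.
Proof.
move=> CQ; exists (~` \bigcup_j C j); split.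
- by apply: measurableC; apply: fin_bigcup_measurable => //; exact: finite_finset.
- rewrite probability_setC ?probability_partition ?C1 ?subee//.
  by apply: fin_bigcup_measurable => //; exact: finite_finset.
- by move=> x /= nQ [j _ Cjx]; apply: nQ; exact: CQ Cjx.
Qed.

(** Almost everywhere [g] is within [del] of the step function with value [c j] on [C j]. This
    bounds [|g|], hence gives integrability, and also bounds the error of the integral. *)
Lemma integral_partition (g : T -> R) (c : J -> R) (del : R) :
  0 <= del -> measurable_fun setT g ->
  (forall j x, C j x -> `|g x - c j| <= del) ->
  P.-integrable setT (EFin \o g) /\
  `|\int[P]_x g x - \sum_j c j * fine (P (C j))| <= del.
Proof.
move=> del0 mg gc.
have ig : P.-integrable setT (EFin \o g).
  apply/integrableP; split; first exact/measurable_EFinP.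
  have M0 : 0 <= \sum_j `|c j| + del by rewrite addr_ge0// sumr_ge0.
  apply: (@le_lt_trans _ _ (\int[P]_x (cst (\sum_j `|c j| + del)%:E x))%E).
    apply: ae_ge0_le_integral => //.
    - by apply: measurableT_comp => //; exact/measurable_EFinP.
    - apply: ae_partition => j x Cjx _; rewrite /= lee_fin -[g x](subrK (c j)).
      rewrite (le_trans (ler_normD _ _))// addrC lerD ?gc//.
      by rewrite (bigD1 j)//= lerDl sumr_ge0.
  rewrite integral_cst// [X in (_ * X)%E](_ : _ = 1%E) ?mule1 ?ltry//.
  exact: probability_setT.
split=> //.
rewrite -lee_fin -abse_EFin EFinB fineK; last exact: integrable_fin_num.
pose h x := \sum_j c j * \1_(C j) x.
have mh : measurable_fun setT h.
  apply: measurable_sum => j; apply: measurable_funM => //.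
have h1 j : P.-integrable setT (fun x => (\1_(C j) x)%:E).
  exact: integrable_indic.
have hE j x : C j x -> h x = c j.
  move=> Cjx; rewrite /h (bigD1 j)//= indicE mem_set// mulr1 big1 ?addr0// => i ij.
  rewrite indicE memNset ?mulr0// => Cix.
  by move/eqP: ij; apply; exact: (tC Cix Cjx).
have hEE x : (h x)%:E = (\sum_j (c j)%:E * (\1_(C j) x)%:E)%E.
  by rewrite -sumEFin.
have ih : P.-integrable setT (EFin \o h).
  rewrite (_ : EFin \o h = fun x => (\sum_j (c j)%:E * (\1_(C j) x)%:E)%E);
    last exact/funext.
  by apply: integrable_sum => // j _; exact: integrableZl.
have -> : ((\sum_j c j * fine (P (C j)))%:E = \int[P]_x (h x)%:E)%E.
  under eq_integral do rewrite hEE.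
  rewrite integral_sum//; last by move=> j; exact: integrableZl.
  rewrite -sumEFin; apply: eq_bigr => j _.
  rewrite integralZl// integral_indic// setIT EFinM fineK//.
  exact: fin_num_measure.
rewrite -integralB_EFin//.
apply: le_trans (le_abse_integral _ _ _) _ => //.
  by apply: emeasurable_funB; exact/measurable_EFinP.
apply: (@le_trans _ _ (\int[P]_x (cst del%:E x))%E); last first.
  rewrite integral_cst// [X in (_ * X)%E](_ : _ = 1%E) ?mule1//.
  exact: probability_setT.
apply: ae_ge0_le_integral => //.
- by apply: measurableT_comp => //; apply: emeasurable_funB; exact/measurable_EFinP.
- by apply: ae_partition => j x Cjx _; rewrite -EFinB abse_EFin lee_fin (hE j)// gc.
Qed.

End finite_partitions.

(** Apply [integral_partition] to [f - g] with the whole space as the only cell and 0 as its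
    value. *)
Lemma Rintegral_dist_le (R : realType) (disp : measure_display)
    (T : measurableType disp) (P : probability T R) (f g : T -> R) (c : R) :
  measurable_fun setT f -> P.-integrable setT (EFin \o g) ->
  (forall x, `|f x - g x| <= c) ->
  P.-integrable setT (EFin \o f) /\ `|\int[P]_x f x - \int[P]_x g x| <= c.
Proof.
move=> mf ig fg.
have mg : measurable_fun setT g by apply/measurable_EFinP; case/integrableP: ig.
have [ifg H] : P.-integrable setT (EFin \o (f \- g)) /\
    `|\int[P]_x (f \- g) x - \sum_(j : unit) 0 * fine (P setT)| <= c.
  apply: (integral_partition (C := fun _ : unit => setT)) => //.
  - by move=> [] [].
  - by rewrite big_const card_unit /= adde0 probability_setT.
  - exact: le_trans (fg point).
  - exact: measurable_funB.
  - by move=> j x _ /=; rewrite subr0.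
have fi : P.-integrable setT (EFin \o f).
  have -> : EFin \o f = (EFin \o (f \- g)) \+ (EFin \o g).
    by apply/funext => x /=; rewrite -EFinD subrK.
  exact: integrableD.
split=> //.
by move: H; rewrite RintegralB//= big1 ?subr0// => j _; rewrite mul0r.
Qed.

(** One construction serves several purposes: a pushforward (a single map), a finitely supported
    measure (constant maps [psi j]), and the operator [M_S] (the maps of the system). *)
Lemma exists_mixture (R : realType) (d1 d2 : measure_display)
    (T1 : measurableType d1) (T2 : measurableType d2) (J : finType) (p : J -> R)
    (P : probability T1 R) (psi : J -> T1 -> T2) :
  (forall j, 0 <= p j) -> \sum_j p j = 1 ->
  (forall j, measurable_fun setT (psi j)) ->
  exists M : probability T2 R,
    (forall A, M A = (\sum_j (p j)%:E * P (psi j @^-1` A))%E) /\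
    (forall f : T2 -> R, measurable_fun setT f ->
       (forall j, P.-integrable setT (fun x => (f (psi j x))%:E)) ->
       \int[M]_x f x = \sum_j p j * \int[P]_x f (psi j x)).
Proof.
move=> p0 p1 mpsi.
have [j0 _|J0] := pickP J; last first.
  by move: p1; rewrite big1 => [/eqP|j]; [rewrite eq_sym oner_eq0|have := J0 j].
(* [msum] adds measures indexed by an initial segment of the naturals, hence the enumeration of
   [J]. *)
pose jn n := nth j0 (enum J) n.
pose mm n : {measure set T2 -> \bar R} :=
  mscale (NngNum (p0 (jn n)))
   (measure_function_pushforward__canonical__measure_function_Measure P (mpsi (jn n))).
have sumE (F : J -> \bar R) : (\sum_(n < #|J|) F (jn n) = \sum_j F j)%E.
  by rewrite -[RHS]big_enum (big_nth j0) -cardE big_mkord.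
pose M0 : {measure set T2 -> \bar R} := msum mm #|J|.
have M0E A : M0 A = (\sum_j (p j)%:E * P (psi j @^-1` A))%E.
  by rewrite -sumE.
have M0T : M0 setT = 1%E.
  rewrite M0E; under eq_bigr do rewrite preimage_setT probability_setT mule1.
  by rewrite sumEFin p1.
pose M : probability T2 R := HB.pack (msum mm #|J|)
  (Measure_isProbability.Build _ _ _ (msum mm #|J|) M0T).
exists M; split=> [A|f mf fi]; first exact: M0E.
(* The formula is proved for nonnegative functions and applied to the positive and negative parts;
   integrability makes all their integrals finite, so they may be subtracted. *)
have ge0_integralM (h : T2 -> \bar R) : measurable_fun setT h ->
    (forall x, 0 <= h x)%E ->
    (\int[M]_x h x = \sum_j (p j)%:E * \int[P]_x h (psi j x))%E.
  move=> mh h0; transitivity (\int[M0]_x h x)%E => //.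
  rewrite ge0_integral_measure_sum// -sumE; apply: eq_bigr => n _.
  by rewrite ge0_integral_mscale//= ge0_integral_pushforward.
have mfE : measurable_fun setT (EFin \o f) by exact/measurable_EFinP.
rewrite /Rintegral integralE !ge0_integralM//;
  [|exact: measurable_funeneg|exact: measurable_funepos].
have pf j : (\int[P]_x ((EFin \o f)^\+%E (psi j x)))%E \is a fin_num.
  have := integrable_pos_fin_num measurableT (fi j).
  by rewrite (funepos_comp (EFin \o f) (psi j)).
have nf j : (\int[P]_x ((EFin \o f)^\-%E (psi j x)))%E \is a fin_num.
  have := integrable_neg_fin_num measurableT (fi j).
  by rewrite (funeneg_comp (EFin \o f) (psi j)).
have fE j : (\int[P]_x (f (psi j x))%:E = \int[P]_x ((EFin \o f)^\+ (psi j x))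
   - \int[P]_x ((EFin \o f)^\- (psi j x)))%E.
  by rewrite integralE (funepos_comp (EFin \o f)) (funeneg_comp (EFin \o f)).
under eq_bigr do rewrite -(fineK (pf _)).
under [X in (_ - X)%E]eq_bigr do rewrite -(fineK (nf _)).
under [RHS]eq_bigr do rewrite fE -(fineK (pf _)) -(fineK (nf _)) mulrBr.
by rewrite !sumEFin -EFinB sumrB.
Qed.

(** * Borel sets and sequential compactness in a metric space *)

Section metric_borel.
Variables (R : realType) (T : pointedType) (d : T -> T -> R).
Hypothesis md : is_metric d.

Let d0 x y : 0 <= d x y. Proof. by case: md. Qed.
Let dxx x : d x x = 0. Proof. by case: md => _ /(_ x x) [_ ->]. Qed.
Let dsym x y : d x y = d y x. Proof. by case: md. Qed.
Let dtri x y z : d x z <= d x y + d y z. Proof. by case: md. Qed.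

Lemma dopen_measurable (A : set T) :
  dopen d A -> measurable (A : set (borel_type d)).
Proof. by move=> oA; exact: sub_sigma_algebra. Qed.

Lemma dball_open x r : dopen d (dball d x r).
Proof.
move=> y; rewrite /dball /= => xy; exists (r - d x y); split; first by rewrite subr_gt0.
by move=> z /=; rewrite ltrBrDl; apply: le_lt_trans.
Qed.

Lemma dcompact_closed (K : set T) : dcompact d K -> dopen d (~` K).
Proof.
move=> cK x nKx; apply: contrapT => nb.
(* A point outside [K] that is not interior to the complement is a limit of points of [K]; the limit
   [z] of a subsequence lies in [K] and must equal it. *)
have H (n : nat) : exists y, K y /\ d x y < n.+1%:R^-1.
  apply: contrapT => ne; apply: nb; exists n.+1%:R^-1; split; first by rewrite invr_gt0.
  by move=> y /= xy Ky; apply: ne; exists y.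
have [u uP] := choice H.
have [s [z [smono [Kz uz]]]] := cK u (fun k => (uP k).1).
suff xz : d x z = 0.
  by case: md => _ /(_ x z) [/(_ xz) xzE _] _ _; apply: nKx; rewrite xzE.
apply/eqP; rewrite eq_le d0 andbT leNgt; apply/negP => xz0.
have [N NP] := uz (d x z / 2) ltac:(by rewrite divr_gt0).
have sk k : (k <= s k)%N.
  by elim: k => // k; move/leq_ltn_trans; apply; exact: smono.
pose M := Num.truncn (2 / d x z).
have M2 : (M.+1%:R)^-1 < d x z / 2.
  rewrite -[X in _ < X]invf_div ltf_pV2 ?posrE ?divr_gt0//.
  exact: truncnS_gt.
pose k := maxn N M.
have h1 : d (u (s k)) z < d x z / 2 by apply: NP; exact: leq_maxl.
have h2 : d x (u (s k)) < d x z / 2.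
  apply: lt_le_trans ((uP (s k)).2) _; apply: le_trans (ltW M2).
  by rewrite lef_pV2 ?posrE// ler_nat ltnS (leq_trans (leq_maxr N M))// sk.
have := dtri x (u (s k)) z; lra.
Qed.

Lemma dcompact_measurable (K : set T) :
  dcompact d K -> measurable (K : set (borel_type d)).
Proof.
move=> /dcompact_closed/dopen_measurable/measurableC; by rewrite setCK.
Qed.

Lemma lipschitz_measurable (f : T -> R) (C : R) : 0 <= C ->
  (forall x y, `|f x - f y| <= C * d x y) ->
  measurable_fun setT (f : borel_type d -> R).
Proof.
move=> C0 lf; apply: (measurability _ (RGenOInfty.measurableE R)).
move=> _ [_ [c ->] <-]; rewrite setTI; apply: dopen_measurable => x /=.
rewrite in_itv/= andbT => cf.
(* Dividing by [C + 1] instead of [C] gives a valid radius also when [C = 0]. *)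
have C1 : 0 < C + 1 by rewrite ltr_wpDl.
exists ((f x - c) / (C + 1)); split; first by rewrite divr_gt0// subr_gt0.
move=> y; rewrite /dball /= in_itv/= andbT ltr_pdivlMr// => xy.
have := lf x y; rewrite ler_norml => /andP[_].
have := d0 x y; nra.
Qed.

(** Otherwise a greedy choice yields a sequence in [K] whose points are pairwise at distance at
    least [del]; no subsequence of it converges. *)
Lemma dcompact_totally_bounded (K : set T) (del : R) : dcompact d K -> 0 < del ->
  exists s : seq T, K `<=` \bigcup_(y in [set` s]) dball d y del.
Proof.
move=> cK del0; apply: contrapT => ns.
have H (s : seq T) : exists x, K x /\ forall y, y \in s -> del <= d y x.
  apply: contrapT => nx; apply: ns; exists s => x Kx.
  apply: contrapT => nb; apply: nx; exists x; split=> // y ys.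
  by rewrite leNgt; apply/negP => yx; apply: nb; exists y.
have [F FP] := choice H.
(* [l n] lists the first [n] chosen points, and [u n] is chosen far from all of them. *)
pose l := fix l n := if n is n'.+1 then F (l n') :: l n' else [::].
pose u n := F (l n).
have lu i j : (i < j)%N -> u i \in l j.
  elim: j => // j IH; rewrite ltnS leq_eqVlt /= inE => /orP[/eqP->|/IH ->].
    by rewrite eqxx.
  by rewrite orbT.
have [s [z [smono [Kz uz]]]] := cK u (fun k => (FP (l k)).1).
have [N NP] := uz (del / 2) ltac:(by rewrite divr_gt0).
have h1 : d (u (s N)) z < del / 2 by exact: NP.
have h2 : d (u (s N.+1)) z < del / 2 by exact: NP.
have h3 : del <= d (u (s N)) (u (s N.+1)) by apply: (FP _).2; exact: lu.
have := dtri (u (s N)) z (u (s N.+1)); rewrite (dsym z); lra.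
Qed.

Lemma dcompact_bounded (K : set T) : dcompact d K -> dbounded d K.
Proof.
move=> cK; have [s sP] := dcompact_totally_bounded cK (ltr01 : 0 < 1 :> R).
exists point, (\sum_(y <- s) d point y + 1) => x /sP[y /= ys yx].
apply: le_trans (dtri _ y _) _; apply: lerD; last exact: ltW.
rewrite (big_rem y)//= lerDl; exact: sumr_ge0.
Qed.

(** Pigeonhole: some value is taken infinitely often, which gives a constant subsequence. *)
Lemma finite_dcompact (K : set T) : finite_set K -> dcompact d K.
Proof.
move=> /finite_seqP[r ->] u ur.
have [x xr xinf] : exists2 x, x \in r & forall N, exists k, (N <= k)%N /\ u k = x.
  apply: contrapT => nx.
  have H x : exists N, x \in r -> forall k, (N <= k)%N -> u k <> x.
    have [xr|xr] := boolP (x \in r); last by exists 0%N.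
    apply: contrapT => nN; apply: nx; exists x => // N.
    apply: contrapT => nk; apply: nN; exists N => _ k Nk ukx.
    by apply: nk; exists k.
  have [N NP] := choice H.
  have := ur (\max_(x <- r) N x)%N => /= uin.
  apply: (NP _ uin _ _ erefl); exact: (leq_bigmax_seq (F := N)).
have [s sP] := choice xinf.
pose t := fix t n := if n is n'.+1 then s (t n').+1 else s 0%N.
exists t, x; split; first by move=> k; exact: (sP _).1.
split=> // e e0; exists 0%N => k _ /=.
by case: k => [|k] /=; rewrite (sP _).2 dxx.
Qed.

(** Removing the earlier balls from each ball makes the cells disjoint and keeps them Borel and
    small. *)
Lemma ball_partition (s : seq T) (del : R) :
  exists B : 'I_(size s) -> set T,
    [/\ forall i, measurable (B i : set (borel_type d)),
        forall i j x, B i x -> B j x -> i = j,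
        forall i, B i `<=` dball d (nth point s i) del &
        \bigcup_(y in [set` s]) dball d y del `<=` \bigcup_i B i].
Proof.
pose F n := dball d (nth point s n) del.
have mF n : measurable (F n : set (borel_type d)).
  by apply: dopen_measurable; exact: dball_open.
exists (fun i => seqDU F i); split.
- by move=> i; apply: measurableD => //; exact: bigsetU_measurable.
- move=> i j x Bi Bj; apply: val_inj.
  by apply: (trivIset_seqDU F) => //; exists x.
- by move=> i; exact: subset_seqDU.
- move=> x [y /= ys yx].
  have : (\big[setU/set0]_(k < size s) F k) x.
    have iy : (index y s < size s)%N by rewrite index_mem.
    by rewrite (bigD1 (Ordinal iy))//=; left; rewrite /F nth_index.
  rewrite bigsetU_seqDU -bigcup_mkord => -[i /= ilt Bi].
  by exists (Ordinal ilt).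
Qed.

End metric_borel.

Lemma dcontinuous_measurable (R : realType) (U T : pointedType)
    (dU : U -> U -> R) (d : T -> T -> R) (f : U -> T) :
  dcontinuous d dU f ->
  measurable_fun setT (f : borel_type dU -> borel_type d).
Proof.
move=> cf; apply: (@measurability _ _ (borel_type dU) (borel_type d)
  setT f (dopen d)) => //.
move=> _ [A oA <-]; rewrite setTI; apply: dopen_measurable => x /= Afx.
have [r [r0 rA]] := oA _ Afx; have [del [del0 delP]] := cf x r r0.
by exists del; split=> // y /delP /rA.
Qed.

Lemma dcompact_image (R : realType) (U T : pointedType)
    (dU : U -> U -> R) (d : T -> T -> R) (f : U -> T) (K : set U) :
  is_metric dU -> is_metric d ->
  dcontinuous d dU f -> dcompact dU K -> dcompact d (f @` K).
Proof.
move=> [_ _ sU _] [_ _ sd _] cf cK u uK.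
have H k : exists x, K x /\ f x = u k by have [x Kx <-] := uK k; exists x.
have [v vP] := choice H.
have [s [z [smono [Kz vz]]]] := cK v (fun k => (vP k).1).
exists s, (f z); split=> //; split; first by exists z.
move=> e e0; have [del [del0 delP]] := cf z e e0.
have [N NP] := vz del del0; exists N => k Nk.
by rewrite /= -(vP _).2 sd; apply: delP; rewrite sU; exact: NP.
Qed.

(** * The maximum metric on a finite power *)

Section max_metric.
Variables (R : realType) (T : pointedType) (d : T -> T -> R) (m : nat).
Hypothesis md : is_metric d.

Lemma dmax_ge (x y : 'I_m -> T) i : d (x i) (y i) <= dmax d x y.
Proof. by rewrite /dmax; exact: (le_bigmax _ (fun i => d (x i) (y i))). Qed.

Lemma dmax_le (x y : 'I_m -> T) (c : R) : 0 <= c ->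
  (forall i, d (x i) (y i) <= c) -> dmax d x y <= c.
Proof. by move=> c0 H; apply: bigmax_le. Qed.

Lemma dmax_metric : is_metric (dmax d : ('I_m -> T) -> _ -> R).
Proof.
case: md => d0 dE ds dt.
have D0 x y : 0 <= dmax (m := m) d x y by exact: bigmax_ge_id.
split=> //.
- move=> x y; split=> [xy|->]; last first.
    by apply/eqP; rewrite eq_le D0 andbT; apply: dmax_le => // i; rewrite (dE _ _).2.
  apply/funext => i; apply/dE/eqP; rewrite eq_le d0 andbT -xy; exact: dmax_ge.
- by move=> x y; apply: eq_bigr => i _; rewrite ds.
- move=> x y z; apply: dmax_le; first by rewrite addr_ge0.
  by move=> i; apply: le_trans (dt _ (y i) _) _; apply: lerD; exact: dmax_ge.
Qed.

(** Coordinate projections are 1-Lipschitz for [dmax d], hence Borel. *)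
Lemma box_measurable (B : 'I_m -> set T) :
  (forall i, measurable (B i : set (borel_type d))) ->
  measurable ([set x | forall i, B i (x i)] : set (borel_type (dmax d))).
Proof.
move=> mB.
have -> : [set x | forall i, B i (x i)] =
    \bigcap_i ((fun x : 'I_m -> T => x i) @^-1` B i).
  by apply/seteqP; split=> x /= H i; [move=> _|]; exact: H.
apply: fin_bigcap_measurable => [|i _]; first exact: finite_finset.
rewrite -[X in measurable X]setTI.
have mp : measurable_fun setT
    ((fun x => x i) : borel_type (dmax d) -> borel_type d).
  apply: dcontinuous_measurable => x e e0; exists e; split=> // y.
  exact/le_lt_trans/(dmax_ge x y).
exact: mp.
Qed.

End max_metric.

(** [K] serves as the only cell, with value [g x0]. The radius [r] depends on neither [g] nor [C],
    which later bounds [dMK] uniformly over test functions. *)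
Lemma lipschitz_integral (R : realType) (T : pointedType) (d : T -> T -> R)
    (P : probability (borel_type d) R) (K : set T) (x0 : T) :
  is_metric d -> dcompact d K -> P K = 1%E ->
  exists2 r : R, 0 <= r & forall (C : R) (g : T -> R), 0 <= C ->
    (forall x y, `|g x - g y| <= C * d x y) ->
    P.-integrable setT (EFin \o (g : borel_type d -> R)) /\
    `|\int[P]_x g x - g x0| <= C * r.
Proof.
move=> md cK PK; have [d0 dE ds dt] := md.
have [y0 [r Kr]] := dcompact_bounded md cK.
have rb x : K x -> d x x0 <= d x0 y0 + `|r|.
  move=> Kx; rewrite ds; apply: le_trans (dt _ y0 _) _; rewrite lerD2l.
  by apply: le_trans (ler_norm r); exact: Kr.
exists (d x0 y0 + `|r|); first by rewrite addr_ge0.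
move=> C g C0 lg.
have [] : P.-integrable setT (EFin \o (g : borel_type d -> R)) /\
    `|\int[P]_x g x - \sum_(j : unit) g x0 * fine (P K)| <= C * (d x0 y0 + `|r|).
  apply: (@integral_partition _ _ _ P unit (fun=> K)).
  - by move=> j; exact: dcompact_measurable.
  - by move=> [] [].
  - by rewrite big_const card_unit /= adde0.
  - by rewrite mulr_ge0// addr_ge0.
  - exact: lipschitz_measurable lg.
  - by move=> _ x Kx; apply: le_trans (lg _ _) _; apply: ler_wpM2l => //; exact: rb.
by rewrite big_const card_unit /= addr0 PK mulr1.
Qed.

(** [inP] requires agreement on all sets, not only Borel ones, so [mu] equals [P] as a function and
    can be rewritten. *)
Lemma inP_measure (R : realType) (T : pointedType) (d : T -> T -> R)
    (mu : set T -> \bar R) : inP d mu ->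
  exists2 P : probability (borel_type d) R, mu = P &
  exists2 K, dcompact d K & P K = 1%E.
Proof.
move=> [P [PE [K [cK muK]]]]; have muP : mu = P by apply/funext.
by exists P => //; exists K => //; rewrite PE.
Qed.

Lemma probability_ge1 (R : realType) (disp : measure_display)
    (T : measurableType disp) (P : probability T R) (A B : set T) :
  measurable A -> measurable B -> A `<=` B -> P A = 1%E -> P B = 1%E.
Proof.
move=> mA mB AB PA; apply/eqP; rewrite eq_le probability_le1//= -PA.
by apply: le_measure => //; rewrite inE.
Qed.

Lemma pushf_inP (R : realType) (U T : pointedType)
    (dU : U -> U -> R) (d : T -> T -> R) (f : U -> T) (mu : set U -> \bar R) :
  is_metric dU -> is_metric d -> dcontinuous d dU f ->
  inP dU mu -> inP d (pushf mu f).
Proof.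
move=> mU md cf /inP_measure[P -> [K cK PK]].
have mf := dcontinuous_measurable cf.
have [//|||M [ME _]] := @exists_mixture R _ _ (borel_type dU) (borel_type d) unit
  (fun=> 1) P (fun=> f).
- by rewrite big_const card_unit /= addr0.
- by move=> _.
exists M; split.
  by move=> A; rewrite ME big_const card_unit /= adde0 mul1e.
exists (f @` K); have cfK := dcompact_image mU md cf cK; split=> //.
apply: (probability_ge1 _ _ _ PK); first exact: dcompact_measurable.
  by rewrite -[X in measurable X]setTI; apply: mf => //; exact: dcompact_measurable.
by move=> x Kx; exists x.
Qed.

Lemma prodmP (R : realType) (T : pointedType) (d : T -> T -> R) (m : nat)
    (mus : 'I_m -> set T -> \bar R) :
  (exists pi, is_prodm d mus pi) -> is_prodm d mus (prodm d mus).
Proof.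
by move=> H; rewrite /prodm; case: pselect => // H'; exact: (projT2 (cid H')).
Qed.

(** * Measures on a proper space are finitely supported *)

Section finite_balls.
Variables (R : realType) (T : pointedType) (d : T -> T -> R).
Hypothesis md : is_metric d.
Hypothesis proper : forall B : set T, dbounded d B -> finite_set B.

Lemma finite_measurable (A : set T) :
  finite_set A -> measurable (A : set (borel_type d)).
Proof. by move=> /(finite_dcompact md)/(dcompact_measurable md). Qed.

(** A compact support is bounded, hence finite, so the measure is a finite sum of point masses. *)
Lemma inP_atomic (mu : set T -> \bar R) : inP d mu ->
  exists (I : finType) (t : I -> T) (w : I -> R),
  [/\ forall i, 0 <= w i, \sum_i w i = 1, mu (range t) = 1%E &
      forall A, measurable (A : set (borel_type d)) ->
        mu A = (\sum_i w i * \1_A (t i))%:E].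
Proof.
move=> /inP_measure[P -> [K cK PK]].
have /finite_seqP[s sE] := proper (dcompact_bounded md cK).
pose t (i : seq_sub s) := ssval i.
have rt : range t = K.
  rewrite sE; apply/seteqP; split=> [_ [i _ <-]|x /= xs]; first exact: ssvalP.
  by exists (SeqSub xs).
have mK : measurable (K : set (borel_type d)) by exact: dcompact_measurable.
have mt i : measurable ([set t i] : set (borel_type d)).
  by apply: finite_measurable; exact: finite_set1.
have AE A : measurable (A : set (borel_type d)) ->
    P A = (\sum_i fine (P [set t i]) * \1_A (t i))%:E.
  move=> mA.
  have PnK : P (A `\` K) = 0%E.
    apply/eqP; rewrite eq_le measure_ge0 andbT.
    have -> : 0%E = P (~` K) by rewrite probability_setC// PK subee.
    apply: le_measure; rewrite ?inE; [exact: measurableD|exact: measurableC|].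
    by move=> x [].
  have -> : P A = P (A `&` K).
    by rewrite [LHS](measureDI P mA mK) [X in (X + _)%E](_ : _ = 0%E)// add0e.
  have -> : A `&` K = \bigcup_i (A `&` [set t i]).
    rewrite -rt; apply/seteqP; split=> [x [Ax [i _ ix]]|x [i _ [Ax ix]]].
      by exists i.
    by split=> //; exists i; rewrite ?ix.
  rewrite probability_partition; first last.
  - by move=> i j x [_ tx] [_ ty]; apply: val_inj; exact: etrans (esym tx) ty.
  - by move=> i; exact: measurableI.
  rewrite -sumEFin; apply: eq_bigr => i _; rewrite indicE.
  have [/set_mem Ati|/negP Ati] := boolP (t i \in A).
    by rewrite mulr1 fineK ?fin_num_measure//; congr (P _); apply/setIidPr => x ->.
  rewrite mulr0 (_ : _ `&` _ = set0) ?measure0//.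
  by apply/seteqP; split=> // x [Ax tx]; apply: Ati; rewrite inE -tx.
exists (seq_sub s), t, (fun i => fine (P [set t i])); split=> //.
- by move=> i; apply: fine_ge0; exact: measure_ge0.
- apply: EFin_inj; rewrite -(probability_setT P) AE//; congr EFin.
  by apply: eq_bigr => i _; rewrite indicT mulr1.
- by rewrite rt.
Qed.

(** The product puts mass [\prod_i w (k i)] at each [t \o k]. Its value on a box factors by
    distributing the product over the sums. *)
Lemma exists_prodm (m : nat) (mu : set T -> \bar R) : inP d mu ->
  exists pi, is_prodm (m := m) d (fun=> mu) pi.
Proof.
move=> muP; have [I [t [w [w0 w1 _ muE]]]] := inP_atomic muP.
(* Any probability would do as [P]: the constant maps below push it to point masses. *)
have [P _ _] := inP_measure muP.
have [|||M [ME _]] := @exists_mixture R _ _ (borel_type d)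
  (borel_type (dmax (m := m) d)) {ffun 'I_m -> I} (fun k => \prod_i w (k i)) P
  (fun k _ => t \o k).
- by move=> k; exact: prodr_ge0.
- exact: (sum_prod_weights (fun=> w1)).
- by move=> k; exact: measurable_cst.
have MB A : M A = (\sum_(k : {ffun 'I_m -> I}) (\prod_i w (k i)) * \1_A (t \o k))%:E.
  rewrite ME -sumEFin; apply: eq_bigr => k _; rewrite EFinM; congr (_ * _)%E.
  rewrite preimage_cst indicE; case: ifP => _; last by rewrite measure0.
  exact: probability_setT.
exists M; split.
  exists M; split=> //; exists (range (fun k : {ffun 'I_m -> I} => t \o k)); split.
    apply: (finite_dcompact (dmax_metric m md)); apply: finite_image.
    exact: finite_finset.
  rewrite MB; under eq_bigr => k _.
    by rewrite indicE mem_set ?mulr1; [over|exists k].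
  by rewrite (sum_prod_weights (fun=> w1)).
move=> B mB; rewrite MB (eq_bigr _ (fun i _ => muE _ (mB i))) prodEFin.
rewrite bigA_distr_bigA/=; congr EFin; apply: eq_bigr => k _.
rewrite big_split/=; congr (_ * _); rewrite indicE.
have [/set_mem /= kB|/negP kB] := boolP (_ \in _).
  by rewrite big1// => i _; rewrite indicE mem_set//; exact: kB.
have [i iB] : exists i, ~ B i (t (k i)).
  by apply/existsNP => H; apply: kB; rewrite inE.
by rewrite (bigD1 i)//= indicE memNset// mul0r.
Qed.

(** The maps [phi j] are only assumed measurable; a compact support comes from the finiteness of the
    set of images of atoms. *)
Lemma MSbar_inP (m L : nat) (p : 'I_L -> R) (phi : 'I_L -> ('I_m -> T) -> T)
    (mu : set T -> \bar R) :
  (forall j, 0 <= p j) -> \sum_j p j = 1 ->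
  (forall j, measurable_fun setT
     (phi j : borel_type (dmax d) -> borel_type d)) ->
  inP d mu -> inP d (MSbar d p phi mu).
Proof.
move=> p0 p1 mphi muP; have [I [t [w [_ _ tr _]]]] := inP_atomic muP.
have [piP piB] := prodmP (exists_prodm m muP).
rewrite /MSbar /MS; have [Q QE _] := inP_measure piP; rewrite QE in piB *.
have [//|//|//|M [ME _]] := @exists_mixture R _ _ (borel_type (dmax (m := m) d))
  (borel_type d) _ p Q phi.
exists M; split=> //.
pose G := range (fun jk : 'I_L * {ffun 'I_m -> I} => phi jk.1 (t \o jk.2)).
have fG : finite_set G by apply: finite_image; exact: finite_finset.
have mt : measurable (range t : set (borel_type d)).
  by apply: finite_measurable; apply: finite_image; exact: finite_finset.
exists G; split; first exact: finite_dcompact.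
rewrite /pushf (eq_bigr (fun j => (p j)%:E)) ?sumEFin ?p1// => j _.
rewrite [X in (_ * X)%E](_ : _ = 1%E) ?mule1//.
apply: (@probability_ge1 _ _ _ Q [set x | forall i, range t (x i)]).
- exact: (box_measurable (d := d) (B := fun=> range t)).
- by rewrite -[X in measurable X]setTI; apply: mphi => //; exact: finite_measurable.
- move=> x xt /=.
  have H i : exists k, t k = x i by have [k _ kx] := xt i; exists k.
  have [k kP] := choice H.
  exists (j, [ffun i => k i]) => //=; congr (phi j _).
  by apply/funext => i /=; rewrite ffunE.
- by rewrite (piB (fun=> range t))// big1.
Qed.

End finite_balls.

(** * Contraction for integrals against product measures *)

Section product_integrals.
Variables (R : realType) (T : pointedType) (d : T -> T -> R) (m : nat).
Hypothesis md : is_metric d.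
Variable a : 'I_m -> R.
Hypothesis a0 : forall i, 0 <= a i.

Lemma sum_dist_le_dmax (x y : 'I_m -> T) :
  \sum_i a i * d (x i) (y i) <= (\sum_i a i) * dmax d x y.
Proof.
rewrite mulr_suml; apply: ler_sum => i _; apply: ler_wpM2l => //.
exact: dmax_ge.
Qed.

(** The boxes built from the cells [B] form a partition for [Q], whose masses are products of cell
    masses. On each box [g] varies from its value at [t \o k] by at most [(\sum_i a i) * del]. *)
Lemma prodm_partition (P : probability (borel_type d) R)
    (Q : probability (borel_type (dmax (m := m) d)) R)
    (I : finType) (B : I -> set T) (t : I -> T) (del : R) :
  is_prodm d (fun=> P : set T -> \bar R) Q -> 0 <= del ->
  (forall i, measurable (B i : set (borel_type d))) ->
  (forall i j x, B i x -> B j x -> i = j) ->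
  (forall i, B i `<=` dball d (t i) del) -> (\sum_i P (B i) = 1)%E ->
  (forall f, lip1 d f ->
     `|\int[P]_x f x - \sum_i f (t i) * fine (P (B i))| <= del) /\
  (forall g : ('I_m -> T) -> R,
     (forall x y, `|g x - g y| <= \sum_i a i * d (x i) (y i)) ->
     `|\int[Q]_x g x -
       \sum_(k : {ffun 'I_m -> I}) g (t \o k) * \prod_i fine (P (B (k i)))|
     <= (\sum_i a i) * del).
Proof.
move=> [_ QB] del0 mB tB Bt B1; have [_ _ dsym _] := md.
have u1 : \sum_i fine (P (B i)) = 1.
  apply: EFin_inj; rewrite -B1 -sumEFin; apply: eq_bigr => i _.
  by rewrite fineK// fin_num_measure.
have A0 : 0 <= \sum_i a i by exact: sumr_ge0.
split=> [f lf|g lg].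
  have [] // := integral_partition (P := P) mB tB B1 (c := fun i => f (t i))
    (g := f) del0.
    by apply: (lipschitz_measurable md ler01) => x y; rewrite mul1r; exact: lf.
  move=> i x /Bt; rewrite /dball /= => tx.
  by apply: le_trans (lf _ _) _; rewrite dsym; exact: ltW.
pose C (k : {ffun 'I_m -> I}) := [set x : 'I_m -> T | forall i, B (k i) (x i)].
have QC k : Q (C k) = (\prod_i fine (P (B (k i))))%:E.
  rewrite (QB (fun i => B (k i)))//; last by move=> i; exact: mB.
  by rewrite -prodEFin; apply: eq_bigr => i _; rewrite fineK// fin_num_measure.
have mC k : measurable (C k : set (borel_type (dmax d))).
  by apply: (box_measurable (B := fun i => B (k i))) => i; exact: mB.
have tC k l x : C k x -> C l x -> k = l.
  by move=> kx lx; apply/ffunP => i; exact: tB (kx i) (lx i).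
have C1 : (\sum_k Q (C k) = 1)%E.
  rewrite (eq_bigr _ (fun k _ => QC k)) sumEFin.
  by rewrite (sum_prod_weights (fun=> u1)).
have [||_] := integral_partition (P := Q) mC tC C1 (c := fun k => g (t \o k))
  (g := g) (mulr_ge0 A0 del0).
- apply: (lipschitz_measurable (dmax_metric m md) A0) => x y.
  exact: le_trans (lg _ _) (sum_dist_le_dmax _ _).
- move=> k x Ckx; apply: le_trans (lg _ _) _; rewrite mulr_suml.
  apply: ler_sum => i _; apply: ler_wpM2l => //=.
  by rewrite dsym; apply/ltW/(Bt (k i)).
by under eq_bigr do rewrite QC.
Qed.

Lemma prodm_contraction (P1 P2 : probability (borel_type d) R)
    (Q1 Q2 : probability (borel_type (dmax (m := m) d)) R)
    (D : R) (g : ('I_m -> T) -> R) :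
  inP d P1 -> inP d P2 ->
  is_prodm d (fun=> P1 : set T -> \bar R) Q1 ->
  is_prodm d (fun=> P2 : set T -> \bar R) Q2 ->
  (forall f, lip1 d f -> `|\int[P1]_x f x - \int[P2]_x f x| <= D) ->
  (forall x y, `|g x - g y| <= \sum_i a i * d (x i) (y i)) ->
  `|\int[Q1]_x g x - \int[Q2]_x g x| <= (\sum_i a i) * D.
Proof.
move=> [_ [_ [K1 [cK1 PK1]]]] [_ [_ [K2 [cK2 PK2]]]] pQ1 pQ2 HD lg.
have A0 : 0 <= \sum_i a i by exact: sumr_ge0.
have dxx x : d x x = 0 by case: md => _ /(_ x x) [_ ->].
apply/ler_addgt0Pl => eta eta0.
(* With [A] the sum of the [a i], the two product integrals cost [A * del] each, and passing from
   [D] to cell weights costs [A * (2 * del)]: in all [4 * A * del], at most [eta]. The [+ 1] covers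
   [A = 0]. *)
pose del := eta / (4 * (\sum_i a i + 1)).
have del0 : 0 < del by rewrite divr_gt0// mulr_gt0// ltr_wpDl.
have [s1 Ks1] := dcompact_totally_bounded md cK1 del0.
have [s2 Ks2] := dcompact_totally_bounded md cK2 del0.
(* Concatenating both nets gives one partition that carries the full mass of [P1] and of [P2], so
   their weights live on the same finite set. *)
have [B [mB tB Bt sB]] := ball_partition md (s1 ++ s2) del.
have full (P : probability (borel_type d) R) K : dcompact d K -> P K = 1%E ->
    K `<=` \bigcup_(y in [set` s1 ++ s2]) dball d y del -> (\sum_i P (B i) = 1)%E.
  move=> cK PK KB; rewrite -probability_partition//.
  apply: (probability_ge1 _ _ _ PK); first exact: dcompact_measurable.
    by apply: fin_bigcup_measurable => //; exact: finite_finset.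
  exact: subset_trans KB sB.
have B1 : (\sum_i P1 (B i) = 1)%E.
  apply: (full P1 K1) => // x /Ks1[y /= ys yx].
  by exists y => //=; rewrite mem_cat ys.
have B2 : (\sum_i P2 (B i) = 1)%E.
  apply: (full P2 K2) => // x /Ks2[y /= ys yx].
  by exists y => //=; rewrite mem_cat ys orbT.
have [f1 g1] := prodm_partition pQ1 (ltW del0) mB tB Bt B1.
have [f2 g2] := prodm_partition pQ2 (ltW del0) mB tB Bt B2.
have u1 (P : probability (borel_type d) R) :
    (\sum_i P (B i) = 1)%E -> \sum_i fine (P (B i)) = 1.
  move=> PB; apply: EFin_inj; rewrite -PB -sumEFin; apply: eq_bigr => i _.
  by rewrite fineK// fin_num_measure.
have u0 (P : probability (borel_type d) R) i : 0 <= fine (P (B i)).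
  by apply: fine_ge0; exact: measure_ge0.
pose t (i : 'I_(size (s1 ++ s2))) := nth point (s1 ++ s2) i.
have HD' f : lip1 d f ->
    `|\sum_i f (t i) * fine (P1 (B i)) - \sum_i f (t i) * fine (P2 (B i))|
    <= D + 2 * del.
  move=> lf; move: (f1 f lf) (f2 f lf) (HD f lf); rewrite -/t !ler_norml.
  by move=> /andP[? ?] /andP[? ?] /andP[? ?]; apply/andP; split; lra.
have := prod_weight_diff dxx (u0 P1) (u0 P2) (u1 _ B1) (u1 _ B2) HD' a0 lg.
move: (g1 g lg) (g2 g lg); rewrite -/t.
have etaE : (\sum_i a i) * (4 * del) <= eta.
  have -> : 4 * del = eta / (\sum_i a i + 1).
    rewrite /del; field; rewrite lt0r_neq0//; first by rewrite ltr_wpDl.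
  by rewrite mulrCA ler_piMr ?(ltW eta0)// ler_pdivrMr ?mul1r ?ltr_wpDl// lerDl.
rewrite !ler_norml mulrDr.
move=> /andP[? ?] /andP[? ?] /andP[? ?]; apply/andP; split; lra.
Qed.

End product_integrals.

(** * The Monge-Kantorovich distance as a real number *)

Section mk_distance.
Variables (R : realType) (T : pointedType) (d : T -> T -> R).
Hypothesis md : is_metric d.
Variables P1 P2 : probability (borel_type d) R.
Hypotheses (inP1 : inP d P1) (inP2 : inP d P2).

Lemma lip1_integrable (P : probability (borel_type d) R) (f : T -> R) :
  inP d P -> lip1 d f -> P.-integrable setT (EFin \o (f : borel_type d -> R)).
Proof.
move=> [_ [_ [K [cK PK]]]] lf.
have [r _ H] := lipschitz_integral point md cK PK.
by apply: (H 1 f ler01 _).1 => x y; rewrite mul1r.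
Qed.

(** Lipschitz functions are integrable against compactly supported measures, so the extended-real
    supremum reduces to real inequalities. *)
Lemma dMK_leP (D : R) :
  (dMK d P1 P2 <= D%:E)%E <->
  forall f, lip1 d f -> `|\int[P1]_x f x - \int[P2]_x f x| <= D.
Proof.
have E f : lip1 d f ->
   (`|\int[P1]_x (f x)%:E - \int[P2]_x (f x)%:E| =
    `|\int[P1]_x f x - \int[P2]_x f x|%R%:E)%E.
  move=> lf; rewrite -abse_EFin EFinB !fineK//.
  - by apply: integrable_fin_num => //; exact: lip1_integrable.
  - by apply: integrable_fin_num => //; exact: lip1_integrable.
split=> [H f lf|H].
  rewrite -lee_fin -E//; apply: le_trans H; apply: ereal_sup_ubound.
  by exists f.
by apply: ge_ereal_sup => _ [f lf <-]; rewrite E// lee_fin; exact: H.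
Qed.

(** Both integrals of a test function [f] are compared with the value [f point], with errors [r1]
    and [r2] independent of [f]. *)
Lemma dMK_finite : exists2 D : R, 0 <= D & dMK d P1 P2 = D%:E.
Proof.
have [_ [_ [K1 [cK1 PK1]]]] := inP1; have [_ [_ [K2 [cK2 PK2]]]] := inP2.
have [r1 r10 H1] := lipschitz_integral point md cK1 PK1.
have [r2 r20 H2] := lipschitz_integral point md cK2 PK2.
have ub : (dMK d P1 P2 <= (r1 + r2)%:E)%E.
  apply/dMK_leP => f lf.
  have lf1 x y : `|f x - f y| <= 1 * d x y by rewrite mul1r.
  have := (H1 1 f ler01 lf1).2; have := (H2 1 f ler01 lf1).2.
  by rewrite !ler_norml => /andP[? ?] /andP[? ?]; apply/andP; split; lra.
have lb : (0 <= dMK d P1 P2)%E.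
  apply: le_trans (ereal_sup_ubound _); last first.
    exists (cst 0) => //= x y; rewrite subrr normr0; by case: md.
  exact: abse_ge0.
have fin : dMK d P1 P2 \is a fin_num.
  by rewrite ge0_fin_numE//; apply: le_lt_trans ub _; rewrite ltry.
by exists (fine (dMK d P1 P2)); rewrite ?fine_ge0// fineK.
Qed.

End mk_distance.

Lemma isometry_continuous (R : realType) (U T : pointedType) (d : T -> T -> R)
    (f : U -> T) : dcontinuous d (fun u v => d (f u) (f v)) f.
Proof. by move=> x e e0; exists e. Qed.

(** * One step of the discretized iteration *)

Section discretization.
Variables (R : realType) (X : pointedType) (d : X -> X -> R).
Variables (m L : nat) (a : 'I_m -> R) (p : 'I_L -> R).
Variable phi : 'I_L -> ('I_m -> X) -> X.
Variables (eps : R) (Xh : pointedType) (e : Xh -> X) (r : X -> Xh).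
Hypothesis md : is_metric d.
Hypothesis a0 : forall i, 0 <= a i.
Hypothesis gifs : is_GIFS d p phi.
Hypothesis contr : forall j, is_acontraction d a (phi j).
Hypothesis inje : injective e.
Hypothesis proper : forall B, dbounded d B -> finite_set (e @^-1` B).
Let dh u v := d (e u) (e v).
Hypothesis mr : measurable_fun setT (r : borel_type d -> borel_type dh).
Hypothesis reps : forall x, d x (e (r x)) <= eps.
Let phih (j : 'I_L) (y : 'I_m -> Xh) := r (phi j (fun i => e (y i))).
Let ev (y : 'I_m -> Xh) := fun i => e (y i).

Lemma induced_metric : is_metric dh.
Proof.
case: md => d0 dE ds dt; split; rewrite /dh //.
by move=> x y; split=> [/dE/inje//|->]; exact/dE.
Qed.

Lemma induced_proper (B : set Xh) : dbounded dh B -> finite_set B.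
Proof.
move=> [x0 [c Bc]]; apply: (sub_finite_set _ (proper (B := [set y | d (e x0) y <= c]) _)).
  by move=> x /Bc.
by exists (e x0), c.
Qed.

Let p0 j : 0 <= p j. Proof. by case: gifs => _ [/(_ j) /ltW]. Qed.
Let p1 : \sum_j p j = 1. Proof. by case: gifs => _ []. Qed.

Let phi_ev_measurable j :
  measurable_fun setT ((fun y => phi j (ev y)) : borel_type (dmax dh) -> borel_type d).
Proof.
apply: dcontinuous_measurable => x c c0.
have [del [del0 delP]] := gifs.1 j (ev x) c c0.
by exists del; split=> // y xy; exact: delP.
Qed.

Lemma phih_measurable j :
  measurable_fun setT (phih j : borel_type (dmax dh) -> borel_type dh).
Proof. exact: (measurableT_comp mr). Qed.

Lemma MSbar_discrete_inP nu : inP dh nu -> inP dh (MSbar dh p phih nu).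
Proof.
apply: (MSbar_inP induced_metric induced_proper p0 p1) => j.
exact: phih_measurable.
Qed.

(** The preimage of a box under [ev] is a box, so a product on the discrete space is transported to
    a product on X. *)
Lemma pushf_prodm (nu : set Xh -> \bar R) (rho : set ('I_m -> Xh) -> \bar R) :
  is_prodm dh (fun=> nu) rho -> is_prodm d (fun=> pushf nu e) (pushf rho ev).
Proof.
move=> [rhoP rhoB]; split.
  apply: (pushf_inP (dmax_metric m induced_metric) (dmax_metric m md)) rhoP.
  by move=> x c c0; exists c.
move=> B mB; rewrite /pushf -(rhoB (fun i => e @^-1` B i))// => i.
have me := dcontinuous_measurable (@isometry_continuous R Xh X d e).
by rewrite /bmeasurable -[X in measurable X]setTI; exact: me measurableT _ (mB i).
Qed.

(* If the product did not exist, [prodm] and hence [MSbar] would vanish. *)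
Lemma fixed_point_prodm (P : probability (borel_type d) R) :
  meq d P (MSbar d p phi P) ->
  is_prodm (m := m) d (fun=> P : set X -> \bar R)
    (prodm d (fun=> P : set X -> \bar R)).
Proof.
move=> fixP; apply: prodmP; apply: contrapT => npi.
have := fixP setT measurableT; rewrite probability_setT /MSbar /MS big1 => [/eqP|j _].
  by rewrite onee_eq0.
by rewrite /pushf /prodm; case: pselect => // _; rewrite mule0.
Qed.

(** For a test function [f] and each [j], the integral of [f (phi j (ev y))] against [S] is the
    intermediate term: the projection [r] moves it by at most [eps], and since [f \o phi j]
    satisfies the hypothesis of [prodm_contraction], it differs from the integral against [Q] by at
    most [(\sum_i a i) * D]. *)
Lemma dMK_step (muS : set X -> \bar R) (nu : set Xh -> \bar R) (D : R) :
  inP d muS -> meq d muS (MSbar d p phi muS) -> inP dh nu ->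
  (dMK d (pushf nu e) muS <= D%:E)%E ->
  (dMK d (pushf (MSbar dh p phih nu) e) muS <= (eps + (\sum_i a i) * D)%:E)%E.
Proof.
move=> muP fixmu nuP; have [P muE _] := inP_measure muP; subst muS.
have mdh := induced_metric.
have A0 : 0 <= \sum_i a i by exact: sumr_ge0.
have piP := fixed_point_prodm fixmu; have [Q QE _] := inP_measure piP.1.
have rhoP := prodmP (exists_prodm mdh induced_proper m nuP).
have [S SE [KS cKS SKS]] := inP_measure rhoP.1.
have nu1P : inP d (pushf nu e).
  exact: (pushf_inP mdh md (@isometry_continuous R Xh X d e)).
have [N1 N1E _] := inP_measure nu1P.
have pi1P := pushf_prodm rhoP; have [S1 S1E _] := inP_measure pi1P.1.
rewrite N1E S1E in pi1P; rewrite N1E in nu1P *; rewrite QE in piP.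
move=> /(dMK_leP md nu1P muP) HD.
have MnuP : inP d (pushf (MSbar dh p phih nu) e).
  apply: (pushf_inP mdh md (@isometry_continuous R Xh X d e)).
  exact: MSbar_discrete_inP.
have me := dcontinuous_measurable (@isometry_continuous R Xh X d e).
have [//|//||M1 [M1E M1int]] := @exists_mixture R _ _ (borel_type (dmax dh))
  (borel_type d) _ p S (fun j y => e (phih j y)).
  by move=> j; apply: (measurableT_comp me); exact: phih_measurable.
have M1nu : pushf (MSbar dh p phih nu) e = M1.
  by apply/funext => A; rewrite M1E /pushf /MSbar /MS /pushf SE.
(* [M2] is the image of [P] under [M_S]. The fixed-point equation identifies it with [P] on Borel
   sets, which is enough for the integrals to agree. *)
have [//|//||M2 [M2E M2int]] := @exists_mixture R _ _ (borel_type (dmax d))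
  (borel_type d) _ p Q phi.
  by move=> j; apply: dcontinuous_measurable; exact: gifs.1.
rewrite M1nu in MnuP *; apply/(dMK_leP md MnuP muP) => f lf.
have mf : measurable_fun setT (f : borel_type d -> R).
  by apply: (lipschitz_measurable md ler01) => x y; rewrite mul1r; exact: lf.
pose g j (x : 'I_m -> X) := f (phi j x).
have lg j x y : `|g j x - g j y| <= \sum_i a i * d (x i) (y i).
  exact: le_trans (lf (phi j x) (phi j y)) (contr j x y).
have lg' j x y : `|g j x - g j y| <= (\sum_i a i) * dmax d x y.
  exact: le_trans (lg j x y) (sum_dist_le_dmax d a0 x y).
have gQ j : Q.-integrable setT (EFin \o (g j : borel_type (dmax d) -> R)).
  have [_ [_ [K [cK QK]]]] := piP.1.
  have [c _ H] := lipschitz_integral point (dmax_metric m md) cK QK.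
  exact: (H _ _ A0 (lg' j)).1.
have gS j : S.-integrable setT (EFin \o (fun y : borel_type (dmax dh) => g j (ev y))).
  have [c _ H] := lipschitz_integral point (dmax_metric m mdh) cKS SKS.
  by apply: (H _ _ A0 _).1 => x y; exact: lg'.
have mev : measurable_fun setT (ev : borel_type (dmax dh) -> borel_type (dmax d)).
  by apply: dcontinuous_measurable => x c c0; exists c.
(* Change of variables along [ev]: [S1], the product of the pushed-forward measure, is the
   pushforward of [S]. *)
have S1int j : \int[S1]_x g j x = \int[S]_y g j (ev y).
  rewrite /Rintegral; congr fine.
  transitivity (\int[pushforward (T1 := borel_type (dmax dh))
      (T2 := borel_type (dmax d)) S ev]_x (g j x)%:E)%E.
    apply: eq_measure_integral => A _ _.
    by rewrite /pushforward -[RHS]/(pushf S ev A) -SE S1E.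
  rewrite (integral_pushforward mev) ?preimage_setT//; last exact: gS.
  by case/integrableP: (gQ j).
have FS j : S.-integrable setT
     (EFin \o (fun y : borel_type (dmax dh) => f (e (phih j y)))) /\
   `|\int[S]_y f (e (phih j y)) - \int[S]_y g j (ev y)| <= eps.
  apply: (Rintegral_dist_le _ (gS j)).
    apply: (measurableT_comp mf); apply: (measurableT_comp me).
    exact: phih_measurable.
  move=> y; apply: le_trans (lf _ _) _; have [_ _ -> _] := md; exact: reps.
rewrite M1int//; last by move=> j; exact: (FS j).1.
have -> : \int[P]_x f x = \int[M2]_x f x.
  rewrite /Rintegral; congr fine; apply: eq_measure_integral => A mA _.
  apply: etrans (fixmu A mA) (etrans _ (esym (M2E A))).
  by rewrite /MSbar /MS /pushf QE.
(* The weights [p j] sum to 1, so a bound valid for every [j] passes to the weighted sum. *)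
rewrite M2int// -sumrB -[leRHS]mul1r -[X in _ <= X * _]p1 mulr_suml.
apply: le_trans (ler_norm_sum _ _ _) _; apply: ler_sum => j _.
rewrite -mulrBr normrM ger0_norm//; apply: ler_wpM2l => //.
have := (FS j).2; have := prodm_contraction md a0 nu1P muP pi1P piP HD (lg j).
rewrite S1int !ler_norml => /andP[? ?] /andP[? ?].
by apply/andP; split; lra.
Qed.

End discretization.


Theorem theorem4p4 (R : realType) (X : pointedType) (d : X -> X -> R)
  (m L : nat) (a : 'I_m -> R) (p : 'I_L -> R) (phi : 'I_L -> ('I_m -> X) -> X)
  (eps : R) (Xh : pointedType) (e : Xh -> X) (r : X -> Xh)
  (muS : set X -> \bar R) (nu : set Xh -> \bar R) :
  is_metric d -> dcomplete d ->
  (0 < m)%N ->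
  (forall i, 0 <= a i) -> \sum_(i < m) a i < 1 ->
  is_GIFS d p phi ->
  (forall j, is_acontraction d a (phi j)) ->
  0 < eps ->
  (* Xh is a subset of X, with inclusion e and the induced metric *)
  injective e ->
  (* proper *)
  (forall B, dbounded d B -> finite_set (e @^-1` B)) ->
  (* eps-net *)
  (forall x, exists y, d x (e y) <= eps) ->
  (* r : X -> Xh is a Borel measurable eps-projection *)
  measurable_fun setT (r : borel_type d -> borel_type (fun u v => d (e u) (e v))) ->
  (forall y, r (e y) = y) ->
  (forall x, d x (e (r x)) <= eps) ->
  is_hutchinson d p phi muS ->
  inP (fun u v => d (e u) (e v)) nu ->
  let alpha := \sum_(i < m) a i in
  let dh := fun u v : Xh => d (e u) (e v) in
  let phih := fun (j : 'I_L) (y : 'I_m -> Xh) => r (phi j (fun i => e (y i))) in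
  (forall n : nat,
     (dMK d (pushf (iter n (MSbar dh p phih) nu) e) muS
      <= (eps / (1 - alpha))%:E + (alpha ^+ n)%:E * dMK d (pushf nu e) muS)%E) /\
  (exists n0 : nat, forall n : nat, (n0 <= n)%N ->
     (dMK d (pushf (iter n (MSbar dh p phih) nu) e) muS
      <= (2 * eps / (1 - alpha))%:E)%E).
Proof.
move=> md _ _ a0 a1 gifs contr eps0 inje proper _ mr _ reps [muP fixmu _] nuP.
move=> alpha dh phih.
have mdh := induced_metric md inje.
have alpha0 : 0 <= alpha by exact: sumr_ge0.
have b0 : 0 < 1 - alpha by rewrite subr_gt0.
have nu1P : inP d (pushf nu e).
  exact: (pushf_inP mdh md (@isometry_continuous R Xh X d e)).
have [D D0 DE] : exists2 D : R, 0 <= D & dMK d (pushf nu e) muS = D%:E.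
  have [P PE _] := inP_measure muP; have [N NE _] := inP_measure nu1P.
  rewrite PE in muP *; rewrite NE in nu1P *; exact: dMK_finite.
have iterP n : inP dh (iter n (MSbar dh p phih) nu).
  elim: n => //= n IH.
  exact: (MSbar_discrete_inP md gifs inje proper mr IH).
(* The closed form of the recursion [eps + alpha * D_n] started at [D]: a partial geometric sum plus
   the contracted initial distance. *)
have bound n : (dMK d (pushf (iter n (MSbar dh p phih) nu) e) muS <=
    (eps * (1 - alpha ^+ n) / (1 - alpha) + alpha ^+ n * D)%:E)%E.
  elim: n => [|n IH]; first by rewrite expr0 subrr mulr0 mul0r add0r mul1r -DE.
  rewrite iterS.
  have := dMK_step md a0 gifs contr inje proper mr reps muP fixmu (iterP n) IH.
  rewrite -/alpha => H; apply: le_trans H _; rewrite lee_fin exprS.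
  by rewrite le_eqVlt; apply/orP; left; apply/eqP; field; rewrite lt0r_neq0.
have main n : (dMK d (pushf (iter n (MSbar dh p phih) nu) e) muS <=
    (eps / (1 - alpha) + alpha ^+ n * D)%:E)%E.
  apply: le_trans (bound n) _; rewrite lee_fin lerD2r ler_pM2r ?invr_gt0//.
  by rewrite ler_piMr ?(ltW eps0)// gerBl exprn_ge0.
split=> [n|]; first by rewrite DE -EFinM -EFinD.
have : alpha ^+ n @[n --> \oo] --> 0 by apply: cvg_expr; rewrite ger0_norm.
(* Once [alpha ^+ n] is below this threshold, [alpha ^+ n * D] is at most [eps / (1 - alpha)]; the
   [+ 1] allows [D = 0]. *)
move=> /cvgrPdist_lt /(_ (eps / (1 - alpha) / (D + 1))) [|n0 _ n0P].
  by rewrite !divr_gt0// ltr_wpDl.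
exists n0 => n /n0P; rewrite sub0r normrN ger0_norm ?exprn_ge0// => small.
apply: le_trans (main n) _; rewrite lee_fin.
have D1 : 0 < D + 1 by rewrite ltr_wpDl.
move: small; rewrite ltr_pdivlMr// => small.
have := exprn_ge0 n alpha0.
rewrite -mulrA; set E := eps / _ in small *; nra.
Qed.
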